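(* Let \[F(x,y)=\sum_{n\geq0}\sum_{k\geq0}op_{n,k}(123)\,x^{n}y^{k},\qquad E(x,y)=\sum_{n\geq0}\sum_{d\geq0}e_{n,d}\,x^{n}y^{d}.\] Then \[F(x,y)=E(xy,1+y^{-1}),\] and consequently \[F(x,y)=\frac{-y-2xy-2x+2x^{2}y+2x^{2}+y\sqrt{1-4xy-4x+4x^{2}y+4x^{2}}}{2x(y+1)^{2}(x-1)}.\]
   Context: Let $[n]=\{1,\dots,n\}$. An ordered partition of $[n]$ with $k$ blocks is a sequence $B_1/B_2/\cdots/B_k$ of nonempty pairwise disjoint subsets of $[n]$ whose union is $[n]$ (the blocks are linearly ordered). For a permutation $\sigma=\sigma_1\cdots\sigma_m\in S_m$, an ordered partition $B_1/\cdots/B_k$ contains $\sigma$ if there are indices $1\le i_1<\cdots<i_m\le k$ and elements $b_j\in B_{i_j}$ such that $b_1\cdots b_m$ is order-isomorphic to $\sigma$ (i.e. $b_l<b_r$ iff $\sigma_l<\sigma_r$); otherwise it avoids $\sigma$. $op_{n,k}(123)$ is the number of ordered partitions of $[n]$ with $k$ blocks avoiding $123$ (with $op_{0,0}(123)=1$). $S_n(123)$ is the set of permutations of $[n]$ with no subsequence order-isomorphic to $123$; for $\sigma\in S_n$, $des(\sigma)=|\{i:\sigma_i>\sigma_{i+1}\}|$; $e_{n,d}$ is the number of $\sigma\in S_n(123)$ with $des(\sigma)=d$ (with $e_{0,0}=1$). *)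

(* Defs.v *)
From HB Require Import structures.
From mathcomp Require Import all_boot all_order all_fingroup all_algebra.
From mathcomp Require Import boolp.

Set Implicit Arguments.
Unset Strict Implicit.
Unset Printing Implicit Defensive.

Import GRing.Theory.

(** * Ordered partitions and permutations avoiding a pattern

    The sets [n] and [k] are represented by 'I_n and 'I_k. *)

Definition ordered_partition (n k : nat) (B : {ffun 'I_k -> {set 'I_n}}) : bool :=
  [&& [forall i, B i != set0],
      [forall i, forall j, (i != j) ==> [disjoint B i & B j]]
    & \bigcup_i B i == [set: 'I_n]].

Definition op_contains (m n k : nat) (sigma : 'S_m)
    (B : {ffun 'I_k -> {set 'I_n}}) : bool :=
  [exists i : {ffun 'I_m -> 'I_k}, exists b : {ffun 'I_m -> 'I_n},
    [&& [forall l : 'I_m, forall r : 'I_m, (l < r) ==> (i l < i r)],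
        [forall j, b j \in B (i j)]
      & [forall l : 'I_m, forall r : 'I_m, (b l < b r) == (sigma l < sigma r)]]].

Definition op (m : nat) (sigma : 'S_m) (n k : nat) : nat :=
  #|[set B : {ffun 'I_k -> {set 'I_n}} |
      ordered_partition B && ~~ op_contains sigma B]|.

Definition perm_contains (m n : nat) (sigma : 'S_m) (s : 'S_n) : bool :=
  [exists i : {ffun 'I_m -> 'I_n},
    [forall l : 'I_m, forall r : 'I_m, (l < r) ==> (i l < i r)] &&
    [forall l : 'I_m, forall r : 'I_m, (s (i l) < s (i r)) == (sigma l < sigma r)]].

Definition des (n : nat) (s : 'S_n) : nat :=
  #|[set i : 'I_n | [exists j : 'I_n, (j == i.+1 :> nat) && (s j < s i)]]|.

Definition av_des (m : nat) (sigma : 'S_m) (n d : nat) : nat :=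
  #|[set s : 'S_n | ~~ perm_contains sigma s && (des s == d)]|.

Definition pat123 : 'S_3 := 1%g.

Lemma op_eq0 m (sigma : 'S_m) n k : n < k -> op sigma n k = 0.
Proof.
move=> ltnk; apply/eqP; rewrite cards_eq0 -subset0; apply/subsetP => B.
rewrite !inE => /andP[/and3P[/forallP B0 /forallP BD _] _].
have /all_tag[f fB] i : {x | x \in B i} by apply: sigW; apply/set0Pn.
suff /leq_card : injective f by rewrite !card_ord leqNgt ltnk.
move=> i j eqf; apply/eqP/negPn/negP => neq.
have /forallP/(_ j)/implyP/(_ neq)/pred0P/(_ (f i)) /= := BD i.
by rewrite fB eqf fB.
Qed.

Lemma av_des_eq0 m (sigma : 'S_m) n d : n < d -> av_des sigma n d = 0.
Proof.
move=> ltnd; apply/eqP; rewrite cards_eq0 -subset0; apply/subsetP => s.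
rewrite !inE => /andP[_ /eqP desd].
by have := max_card [set i : 'I_n | [exists j : 'I_n,
  (j == i.+1 :> nat) && (s j < s i)]]; rewrite card_ord -/(des s) desd leqNgt ltnd.
Qed.

(** * Formal power series in one variable *)

Local Open Scope ring_scope.

Record fps (R : Type) : Type := Fps { fcoef : nat -> R }.

Lemma fpsP (R : Type) (f g : fps R) : (forall n, fcoef f n = fcoef g n) <-> f = g.
Proof.
split=> [|-> //]; case: f g => [f] [g] /= fg; congr Fps; exact/funext.
Qed.

HB.instance Definition _ (R : Type) := gen_eqMixin (fps R).
HB.instance Definition _ (R : Type) := gen_choiceMixin (fps R).

Section FpsZmodule.
Variable R : zmodType.
Implicit Types f g h : fps R.

Definition fps_zero : fps R := Fps (fun=> 0).
Definition fps_opp f : fps R := Fps (fun n => - fcoef f n).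
Definition fps_add f g : fps R := Fps (fun n => fcoef f n + fcoef g n).

Let addA : associative fps_add.
Proof. by move=> f g h; apply/fpsP => n /=; rewrite addrA. Qed.
Let addC : commutative fps_add.
Proof. by move=> f g; apply/fpsP => n /=; rewrite addrC. Qed.
Let add0 : left_id fps_zero fps_add.
Proof. by move=> f; apply/fpsP => n /=; rewrite add0r. Qed.
Let addN : left_inverse fps_zero fps_opp fps_add.
Proof. by move=> f; apply/fpsP => n /=; rewrite addNr. Qed.

HB.instance Definition _ := GRing.isZmodule.Build (fps R) addA addC add0 addN.

Lemma fcoef0 n : fcoef (0 : fps R) n = 0. Proof. by []. Qed.
Lemma fcoefN f n : fcoef (- f) n = - fcoef f n. Proof. by []. Qed.
Lemma fcoefD f g n : fcoef (f + g) n = fcoef f n + fcoef g n. Proof. by []. Qed.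
Lemma fcoefB f g n : fcoef (f - g) n = fcoef f n - fcoef g n. Proof. by []. Qed.
Lemma fcoef_sum I (r : seq I) (P : pred I) (F : I -> fps R) n :
  fcoef (\sum_(i <- r | P i) F i) n = \sum_(i <- r | P i) fcoef (F i) n.
Proof. by elim/big_rec2: _ => // i x y _ <-. Qed.

End FpsZmodule.

Section FpsRing.
Variable R : comNzRingType.
Implicit Types f g h : fps R.

Definition fpsC (c : R) : fps R := Fps (fun n => if n == 0%N then c else 0).
Definition fpsX : fps R := Fps (fun n => (n == 1%N)%:R).

Definition fps_mul f g : fps R :=
  Fps (fun n => \sum_(i < n.+1) fcoef f i * fcoef g (n - i)%N).

Definition fps_trunc (m : nat) f : {poly R} := \poly_(i < m) fcoef f i.

Lemma coef_trunc m f i : (i < m)%N -> (fps_trunc m f)`_i = fcoef f i.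
Proof. by move=> im; rewrite coef_poly im. Qed.

Lemma fps_mul_trunc m f g n : (n < m)%N ->
  fcoef (fps_mul f g) n = (fps_trunc m f * fps_trunc m g)`_n.
Proof.
move=> nm; rewrite coefM; apply: eq_bigr => i _.
rewrite !coef_trunc //; first exact: leq_ltn_trans (leq_subr _ _) nm.
by apply: leq_ltn_trans nm; rewrite -ltnS.
Qed.

Let mulC : commutative fps_mul.
Proof.
by move=> f g; apply/fpsP => n; rewrite !(@fps_mul_trunc n.+1) // mulrC.
Qed.

Let mulA : associative fps_mul.
Proof.
move=> f g h; apply/fpsP => n.
transitivity ((fps_trunc n.+1 f * (fps_trunc n.+1 g * fps_trunc n.+1 h))`_n).
  rewrite coefM; apply: eq_bigr => i _.
  rewrite coef_trunc ?ltn_ord // (@fps_mul_trunc n.+1) //.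
  by rewrite ltnS leq_subr.
rewrite mulrA coefM; apply: eq_bigr => i _.
by rewrite coef_trunc ?ltnS ?leq_subr // (@fps_mul_trunc n.+1).
Qed.

Let mul1 : left_id (fpsC 1) fps_mul.
Proof.
move=> f; apply/fpsP => n /=; rewrite big_ord_recl subn0 mul1r big1 ?addr0 //.
by move=> i _; rewrite mul0r.
Qed.

Let mulD : left_distributive fps_mul (@fps_add R).
Proof.
move=> f g h; apply/fpsP => n /=; rewrite -big_split.
by apply: eq_bigr => i _; rewrite mulrDl.
Qed.

Let one_neq0 : fpsC 1 != 0.
Proof.
by apply/eqP => /fpsP/(_ 0%N) /= /eqP; rewrite oner_eq0.
Qed.

HB.instance Definition _ :=
  GRing.Zmodule_isComNzRing.Build (fps R) mulA mulC mul1 mulD one_neq0.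

Lemma fcoefM f g n :
  fcoef (f * g) n = \sum_(i < n.+1) fcoef f i * fcoef g (n - i)%N.
Proof. by []. Qed.

Lemma fcoefC c n : fcoef (fpsC c) n = if n == 0%N then c else 0.
Proof. by []. Qed.

Lemma fcoefX n : fcoef fpsX n = (n == 1%N)%:R.
Proof. by []. Qed.

Lemma fpsC_is_zmod_morphism : zmod_morphism fpsC.
Proof. by move=> a b; apply/fpsP => -[|n] //=; rewrite subr0. Qed.

Lemma fpsC_is_monoid_morphism : monoid_morphism fpsC.
Proof.
split=> // a b; apply/fpsP => n; rewrite fcoefM big_ord_recl big1 ?addr0 /=.
  by rewrite subn0; case: eqP; rewrite ?mulr0.
by move=> i _; rewrite mul0r.
Qed.

HB.instance Definition _ :=
  GRing.isZmodMorphism.Build R (fps R) fpsC fpsC_is_zmod_morphism.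
HB.instance Definition _ :=
  GRing.isMonoidMorphism.Build R (fps R) fpsC fpsC_is_monoid_morphism.

Lemma fcoefM_exp_lt (w u : fps R) (i n : nat) :
  fcoef u 0 = 0 -> (n < i)%N -> fcoef (w * u ^+ i) n = 0.
Proof.
move=> u0; elim: i n => // i IHi n; rewrite exprSr mulrA => nlt.
rewrite fcoefM big1 // => j _; case: (ltnP j i) => ji; first by rewrite IHi ?mul0r.
suff -> : (n - j = 0)%N by rewrite u0 mulr0.
by apply/eqP; rewrite subn_eq0 (leq_trans _ ji).
Qed.

End FpsRing.

Section FpsUnitRing.
Variable R : comNzRingType.
Implicit Types f g : fps R.

Definition fps_unit : pred (fps R) := fun f => `[< exists g, g * f = 1 >].

Definition fps_inv f : fps R :=
  if pselect (exists g, g * f = 1) is left fV then projT1 (cid fV) else f.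

Let mulV : {in fps_unit, left_inverse 1 fps_inv *%R}.
Proof.
move=> f /asboolP fV; rewrite /fps_inv; case: pselect => // fV'.
by case: cid.
Qed.

Let unitP f g : g * f = 1 -> fps_unit f.
Proof. by move=> gf; apply/asboolP; exists g. Qed.

Let inv_out : {in [predC fps_unit], fps_inv =1 id}.
Proof.
move=> f /negP nfV; rewrite /fps_inv; case: pselect => // fV.
by case: nfV; apply/asboolP.
Qed.

HB.instance Definition _ :=
  GRing.ComNzRing_hasMulInverse.Build (fps R) mulV unitP inv_out.

End FpsUnitRing.

Section FpsIdomain.
Variable R : idomainType.
Implicit Types f g : fps R.

Lemma fps_low f : f != 0 ->
  exists n, fcoef f n != 0 /\ forall m, (m < n)%N -> fcoef f m = 0.
Proof.
move=> f0; have exn : exists n, fcoef f n != 0.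
  apply: contrapT => /forallNP all0; case/eqP: f0; apply/fpsP => n.
  by apply/eqP/negPn/negP/all0.
case: (ex_minnP exn) => n fn minn; exists n; split=> // m mn.
by apply/eqP/negPn/negP => /minn; rewrite leqNgt mn.
Qed.

Let mulf0 f g : f * g = 0 -> (f == 0) || (g == 0).
Proof.
move=> fg0; apply/negPn/negP; rewrite negb_or => /andP[].
move=> /fps_low[i [fi fi0]] /fps_low[j [gj gj0]].
have lti : (i < (i + j).+1)%N by rewrite ltnS leq_addr.
have /fpsP/(_ (i + j)%N) := fg0; rewrite fcoefM fcoef0.
rewrite (bigD1 (Ordinal lti)) //= addKn big1 => [|l neq].
  by move/eqP; rewrite addr0 mulf_eq0 (negPf fi) (negPf gj).
case: (ltngtP l i) => [li|il|eqli]; first by rewrite fi0 ?mul0r.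
  rewrite gj0 ?mulr0 //.
  by rewrite -(ltn_add2r l) subnK ?[(j + l)%N]addnC ?ltn_add2r // -ltnS.
by case/eqP: neq; apply: val_inj.
Qed.

HB.instance Definition _ := GRing.ComUnitRing_isIntegral.Build (fps R) mulf0.

End FpsIdomain.

Lemma fpsC_inv (K : fieldType) (c : K) : c != 0 -> (fpsC c)^-1 = fpsC c^-1.
Proof. by move=> c0; rewrite rmorphV // unitfE. Qed.

(** * Square root of a power series with constant term 1 *)

Section FpsSqrt.
Variable K : fieldType.

(* The list of the first [n] coefficients of the square root of [g] with
   constant term 1, obtained by solving s_0 = 1 and
   2 s_m = g_m - sum_(0 < i < m) s_i s_(m - i). *)
Fixpoint sqrt_seq (g : fps K) (n : nat) : seq K :=
  if n is m.+1 then
    let s := sqrt_seq g m in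
    rcons s (if m == 0%N then 1
             else (fcoef g m - \sum_(1 <= i < m) s`_i * s`_(m - i)) / 2%:R)
  else [::].

Definition fps_sqrt (g : fps K) : fps K := Fps (fun n => (sqrt_seq g n.+1)`_n).

Lemma size_sqrt_seq g n : size (sqrt_seq g n) = n.
Proof. by elim: n => //= n IHn; rewrite size_rcons IHn. Qed.

Lemma nth_sqrt_seq g n i : (i < n)%N -> (sqrt_seq g n)`_i = fcoef (fps_sqrt g) i.
Proof.
elim: n => // n IHn; rewrite ltnS leq_eqVlt => /predU1P[-> //|lin].
by rewrite /= nth_rcons size_sqrt_seq lin IHn.
Qed.

Lemma fps_sqrt0 g : fcoef (fps_sqrt g) 0 = 1.
Proof. by []. Qed.

Lemma fcoef_sqrtS g n : fcoef (fps_sqrt g) n.+1 = (fcoef g n.+1 -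
  \sum_(i < n) fcoef (fps_sqrt g) i.+1 * fcoef (fps_sqrt g) (n - i)) / 2%:R.
Proof.
transitivity (nth 0 (sqrt_seq g n.+2) n.+1) => //.
have -> : sqrt_seq g n.+2 = rcons (sqrt_seq g n.+1) ((fcoef g n.+1 -
  \sum_(1 <= i < n.+1) (sqrt_seq g n.+1)`_i * (sqrt_seq g n.+1)`_(n.+1 - i))
    / 2%:R) by [].
rewrite nth_rcons size_sqrt_seq ltnn eqxx big_add1 big_mkord.
congr ((_ - _) / _); rewrite -[n.+1.-1]/n; apply: eq_bigr => i _.
by rewrite subSS !nth_sqrt_seq ?ltnS ?leq_subr.
Qed.

Lemma fps_sqrtK g : 2%:R != 0 :> K -> fcoef g 0 = 1 -> fps_sqrt g ^+ 2 = g.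
Proof.
move=> nz2 g0; apply/fpsP => -[|n]; rewrite expr2 fcoefM.
  by rewrite big_ord1 subnn fps_sqrt0 mulr1 g0.
have := fcoef_sqrtS g n; set s := fcoef (fps_sqrt g); move=> sS.
rewrite big_ord_recl big_ord_recr subn0 subnn.
rewrite [s _]fps_sqrt0 mul1r mulr1 addrCA -mulr2n -mulr_natr sS divfK //.
by rewrite addrC subrK.
Qed.

End FpsSqrt.

(** * Bivariate generating functions *)

(* The sum over i and d of [a i d * u ^ i * v ^ d], for a power series [u] with
   zero constant term and a family [a] with [a i d = 0] for [i < d]: under these
   conditions only the terms with [d <= i <= n] contribute to the coefficient of
   degree [n] (see [fcoefM_exp_lt], [op_eq0] and [av_des_eq0]). *)
Definition bgf (R : comNzRingType) (a : nat -> nat -> nat) (u v : fps R) : fps R :=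
  Fps (fun n => fcoef (\sum_(i < n.+1) (\sum_(d < i.+1) (a i d)%:R * v ^+ d) * u ^+ i) n).

Definition F (R : comNzRingType) : fps R -> fps R -> fps R := bgf (op pat123).
Definition E (R : comNzRingType) : fps R -> fps R -> fps R := bgf (av_des pat123).

(** * The field Q(y) of coefficients *)

Notation "x %:F" := (@FracField.tofrac _ x) : ring_scope.

Definition Qy : fieldType := {fraction {poly rat}}.

(* Main.v *)
Require Import Defs.
From mathcomp Require Import all_boot all_order all_fingroup all_algebra.
From mathcomp Require Import ring zify.

(** Write the blocks of an ordered partition in decreasing order and concatenate
    them: the partition avoids 123 iff the resulting permutation [s] does, and it
    is recovered from [s] by marking the [n - k] descents of [s] that lie inside a
    block.  Hence [op n k] is the sum of ['C(des s, n - k)] over the 123-avoiding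
    [s], which gives the first identity.

    For the closed form, build 123-avoiding permutations by adding a new first
    letter.  If the [l] largest values of [s] are in decreasing order ([l]
    maximal), the admissible new letters give permutations with parameter
    [l + 1] (a new maximum) or any of [1, ..., l], and the only ascents created
    are those of a non-maximal letter put before a maximal one.  After the
    substitution the weighted number of descendants of a node of parameter [l]
    has generating function [G ^ (l + 1)] when its first letter is not the
    maximum, where [G = 1 + x (1 - x) (1 + y) G ^ 2], so that
    [F = 1 + x y (1 - x) G ^ 2]. *)

Set Implicit Arguments.
Unset Strict Implicit.
Unset Printing Implicit Defensive.

Import GRing.Theory.

Local Open Scope nat_scope.

(** * Occurrences of 123 as explicit triples *)

Definition av123 n (s : 'S_n) := ~~ perm_contains pat123 s.

Local Notation o1 := (@Ordinal 3 1 isT).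

Lemma ord3P (l : 'I_3) : [\/ l = ord0, l = o1 | l = ord_max].
Proof.
by case: l => [[|[|[|l]]] lP] //; [constructor 1|constructor 2|constructor 3];
  apply: val_inj.
Qed.

Lemma incr3P (f : 'I_3 -> nat) :
  reflect (f ord0 < f o1 /\ f o1 < f ord_max)
          [forall l : 'I_3, forall r : 'I_3, (l < r) ==> (f l < f r)].
Proof.
apply: (iffP forallP) => [f_incr|[f01 f12] l].
  have fE l r := implyP (forallP (f_incr l) r).
  by split; apply: fE.
apply/forallP => r; apply/implyP.
have f02 := ltn_trans f01 f12.
by case: (ord3P l) (ord3P r) => -> [] ->.
Qed.

Lemma mono3P (f : 'I_3 -> nat) :
  reflect (f ord0 < f o1 /\ f o1 < f ord_max)
    [forall l : 'I_3, forall r : 'I_3, (f l < f r) == (pat123 l < pat123 r)].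
Proof.
apply: (iffP forallP) => [f_mono|/incr3P/forallP f_incr l].
  have fE l r := eqP (forallP (f_mono l) r).
  by split; rewrite fE !perm1.
have fE l' r' := implyP (forallP (f_incr l') r').
apply/forallP => r; rewrite !perm1; apply/eqP.
case: (ltngtP l r) => [/fE-> //|/fE/ltnW|/val_inj->]; last by rewrite ltnn.
by rewrite leqNgt => /negPf.
Qed.

Lemma perm_contains123P n (s : 'S_n) :
  reflect (exists i j k : 'I_n, [/\ i < j, j < k, s i < s j & s j < s k])
          (perm_contains pat123 s).
Proof.
apply: (iffP existsP) => [[f /andP[/incr3P[? ?] /mono3P[? ?]]]|[i [j [k [? ? ? ?]]]]].
  by exists (f ord0), (f o1), (f ord_max).
exists [ffun l : 'I_3 => nth i [:: i; j; k] l].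
by apply/andP; split; [apply/incr3P | apply/mono3P]; rewrite !ffunE.
Qed.

Lemma op_contains123P n k (B : {ffun 'I_k -> {set 'I_n}}) :
  reflect (exists i j l : 'I_k, exists a b c : 'I_n,
             [/\ i < j < l, a < b < c & [/\ a \in B i, b \in B j & c \in B l]])
          (op_contains pat123 B).
Proof.
apply: (iffP existsP) => [[f /existsP[g]]|[i [j [l [a [b [c [H1 H2 [Ba Bb Bc]]]]]]]]].
  case/and3P => /incr3P[f1 f2] /forallP gB /mono3P[g1 g2].
  exists (f ord0), (f o1), (f ord_max), (g ord0), (g o1), (g ord_max).
  by split; [apply/andP|apply/andP|].
exists [ffun r : 'I_3 => nth i [:: i; j; l] r]; apply/existsP.
exists [ffun r : 'I_3 => nth a [:: a; b; c] r].
case/andP: H1 => ? ?; case/andP: H2 => ? ?.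
apply/and3P; split; [apply/incr3P | | apply/mono3P]; rewrite ?ffunE //.
by apply/forallP => -[[|[|[|r]]] //= rP]; rewrite !ffunE.
Qed.


(** * Adding a new first letter to a permutation *)

Lemma big_perm_first (T : Type) (idx : T) (mop : Monoid.com_law idx)
    (m : nat) (h : 'S_m.+1 -> T) :
  \big[mop/idx]_(s : 'S_m.+1) h s
  = \big[mop/idx]_(s : 'S_m) \big[mop/idx]_(j : 'I_m.+1) h (lift_perm ord0 j s).
Proof.
rewrite pair_big /=.
pose ins (p : 'S_m * 'I_m.+1) := lift_perm ord0 p.2 p.1.
have ins_inj : injective ins.
  move=> [s1 j1] [s2 j2] /permP eqs; have := eqs ord0.
  rewrite /ins !lift_perm_id /= => eqj; subst j2; congr (_, _).
  apply/permP => i; apply: (@lift_inj _ j1).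
  by have := eqs (lift ord0 i); rewrite /ins !lift_perm_lift.
(* Injectivity suffices, since [m! * (m + 1) = (m + 1)!]. *)
rewrite (reindex ins) //=; apply: onW_bij; apply: inj_card_bij ins_inj _.
by rewrite card_prod !card_Sn card_ord factS mulnC.
Qed.

Definition has_larger_after m (s : 'S_m) (i : 'I_m) :=
  [exists j : 'I_m, (i < j) && (s i < s j)].

(** A new first letter [j] creates a 123 exactly when it can play the 1 before an increasing pair of
    [s], so the admissible letters are those with [asc_bound s <= j]. The successor makes the bound
    0 when [s] is decreasing. *)
Definition asc_bound m (s : 'S_m) : nat :=
  \max_(i | has_larger_after s i) (s i).+1.

(* The largest [l] such that the [l] largest values of [s] occur in decreasing order. *)
Definition top_run m (s : 'S_m) : nat := m - asc_bound s.

Definition max_first m (s : 'S_m.+1) : bool := s ord0 == ord_max.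

Lemma ltn_asc_bound m (s : 'S_m) (a b : 'I_m) :
  a < b -> s a < s b -> s a < asc_bound s.
Proof.
move=> ab sab; apply: (@leq_bigmax_cond _ _ (fun i => (s i).+1)).
by apply/existsP; exists b; rewrite ab.
Qed.

Lemma asc_bound_leP m (s : 'S_m) q :
  reflect (forall a b : 'I_m, a < b -> s a < s b -> s a < q) (asc_bound s <= q).
Proof.
apply: (iffP idP) => [le_q a b ab sab|lt_q].
  exact: leq_trans (ltn_asc_bound ab sab) le_q.
by apply/bigmax_leqP => a /existsP[b /andP[ab sab]]; apply: lt_q sab.
Qed.

Lemma asc_bound_size m (s : 'S_m) : asc_bound s <= m.
Proof. by apply/asc_bound_leP. Qed.

(** The maximum comes after a first letter that differs from it. *)
Lemma ltn_asc_bound_first m (s : 'S_m.+1) :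
  ~~ max_first s -> s ord0 < asc_bound s.
Proof.
move=> s0; have max0 : s^-1%g ord_max != ord0.
  by apply: contra s0 => /eqP eq0; rewrite /max_first -eq0 permKV.
apply: (@ltn_asc_bound _ _ _ (s^-1%g ord_max)); first by rewrite lt0n.
by rewrite permKV ltn_neqAle -ltnS ltn_ord andbT.
Qed.

Section Insertion.
Variables (m : nat) (s : 'S_m) (j : 'I_m.+1).
Local Notation t := (lift_perm ord0 j s).

Let ltn_lift (a b : 'I_m) : (t (lift ord0 a) < t (lift ord0 b)) = (s a < s b).
Proof. by rewrite !lift_perm_lift /= /bump; lia. Qed.

Let ltn_first (a : 'I_m) : (j < t (lift ord0 a)) = (j <= s a).
Proof. by rewrite lift_perm_lift /= /bump; lia. Qed.

(** A 123 in [t] either misses the first letter, and is one of [s], or uses it as its 1, followed by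
    an increasing pair of [s] that starts at a value at least [j]. *)
Lemma av123_lift : av123 t = av123 s && (asc_bound s <= j).
Proof.
rewrite /av123; apply/idP/andP => [av|[av /asc_bound_leP le_j]].
  split.
    apply: contra av => /perm_contains123P[a [b [c [? ? ? ?]]]].
    apply/perm_contains123P.
    by exists (lift ord0 a), (lift ord0 b), (lift ord0 c); rewrite !ltn_lift.
  apply/asc_bound_leP => a b ab sab; rewrite ltnNge; apply: contra av => ja.
  apply/perm_contains123P; exists ord0, (lift ord0 a), (lift ord0 b).
  by rewrite ltn_lift lift_perm_id ltn_first.
apply: contra av => /perm_contains123P[a [b [c []]]].
case: (unliftP ord0 c) => [c'|] -> //.
case: (unliftP ord0 b) => [b'|] -> // ab bc tab.
rewrite ltn_lift => sbc; move: ab tab.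
case: (unliftP ord0 a) => [a'|] -> ab; last first.
  by rewrite lift_perm_id ltn_first leqNgt (le_j _ _ bc sbc).
by rewrite ltn_lift => sab; apply/perm_contains123P; exists a', b', c'.
Qed.

(** The old values with a larger one after them are below [j], hence not shifted. The first letter
    joins them, and dominates them, unless it is the maximum. *)
Lemma asc_bound_lift : asc_bound s <= j ->
  asc_bound t = if j == ord_max then asc_bound s else j.+1.
Proof.
move=> le_j; apply/eqP; rewrite eqn_leq.
have jm : (j == ord_max) = (m <= j).
  by rewrite -val_eqE /= eqn_leq -ltnS ltn_ord.
apply/andP; split.
  apply/asc_bound_leP => a b.
  case: (unliftP ord0 b) => [b'|] -> //.
  case: (unliftP ord0 a) => [a'|] -> ab.
    rewrite ltn_lift => sab; have := ltn_asc_bound (ab : a' < b') sab.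
    by rewrite lift_perm_lift /= /bump; case: ifP; lia.
  rewrite lift_perm_id ltn_first jm => jb.
  by case: ifP => //; have := ltn_ord (s b'); lia.
case: ifPn => [jmax|jmax].
  apply/asc_bound_leP => a b ab sab.
  have : t (lift ord0 a) < asc_bound t.
    by apply: (@ltn_asc_bound _ _ _ (lift ord0 b)) => //; rewrite ltn_lift.
  by apply: leq_trans; rewrite lift_perm_lift /= /bump; lia.
rewrite -{1}(lift_perm_id ord0 j s); apply: ltn_asc_bound_first.
by rewrite /max_first lift_perm_id.
Qed.

Lemma max_first_lift : max_first t = (j == ord_max).
Proof. by rewrite /max_first lift_perm_id. Qed.

End Insertion.

Lemma des_lift m (s : 'S_m.+1) (j : 'I_m.+2) :
  des (lift_perm ord0 j s) = (s ord0 < j) + des s.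
Proof.
rewrite /des !cardsE -!sum1_card [LHS]big_mkcond [in RHS]big_mkcond big_ord_recl.
congr (_ + _).
  rewrite -[LHS]/(nat_of_bool _) unfold_in; congr nat_of_bool.
  apply/existsP/idP => [[k /andP[/eqP k1]]|s0j].
    have -> : k = lift ord0 ord0 by apply: val_inj.
    by rewrite lift_perm_id lift_perm_lift /= /bump; lia.
  exists (lift ord0 ord0); rewrite lift_perm_id lift_perm_lift /= /bump.
  by lia.
apply: eq_bigr => i _; rewrite !unfold_in; congr (nat_of_bool _).
apply/existsP/existsP => [[k]|[k /andP[ki sk]]].
  case: (unliftP ord0 k) => [k'|] -> /andP[ki].
    rewrite !lift_perm_lift => sk; exists k'; move: ki sk => /=.
    by rewrite /bump; lia.
  by move: ki.
exists (lift ord0 k); rewrite !lift_perm_lift; move: ki sk => /=.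
by rewrite /bump; lia.
Qed.

(** * Ordered partitions as surjections, and their reading permutations *)

Lemma card_ord_ltn n a : a <= n -> #|[set b : 'I_n | b < a]| = a.
Proof.
move=> le_an; rewrite -sum1dep_card.
by rewrite -(big_ord_widen n (fun=> 1) le_an) sum1_card card_ord.
Qed.

Lemma ord_ltn_trans_next n (r : rel 'I_n) :
  transitive r -> (forall a b : 'I_n, b = a.+1 :> nat -> r a b) ->
  forall a b : 'I_n, a < b -> r a b.
Proof.
move=> r_trans r_next a [b lt_bn] /=; elim: b lt_bn => // b IHb lt_bn.
rewrite ltnS leq_eqVlt => /predU1P[eq_ab|lt_ab].
  by apply: r_next; rewrite eq_ab.
have lt_b := ltn_trans (ltnSn b) lt_bn.
by apply: r_trans (IHb lt_b lt_ab) _; apply: r_next.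
Qed.

Definition surjb n k (f : {ffun 'I_n -> 'I_k}) : bool :=
  [forall i, [exists v, f v == i]].

Definition blocks n k (f : {ffun 'I_n -> 'I_k}) : {ffun 'I_k -> {set 'I_n}} :=
  [ffun i => [set v | f v == i]].

(** Disjoint blocks that cover amount to a map sending each element to the index of its block;
    nonempty blocks make it surjective. *)
Lemma op_surj n k : op pat123 n k =
  #|[set f : {ffun 'I_n -> 'I_k} | surjb f && ~~ op_contains pat123 (blocks f)]|.
Proof.
have blocks_inj : injective (@blocks n k).
  move=> f g /ffunP eq_fg; apply/ffunP => v; apply/eqP.
  have := eq_fg (g v); rewrite !ffunE => /setP/(_ v).
  by rewrite !inE eqxx.
rewrite -(card_imset _ blocks_inj) /op; apply: eq_card => B.
apply/idP/imsetP => [|[f]]; rewrite inE; last first.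
  move=> /andP[/forallP f_surj avf] ->; rewrite inE avf andbT.
  apply/and3P; split.
  - apply/forallP => i; case/existsP: (f_surj i) => v /eqP fv.
    by apply/set0Pn; exists v; rewrite ffunE inE fv.
  - apply/forallP => i; apply/forallP => j; apply/implyP => neq_ij.
    apply/pred0P => v; rewrite /= !ffunE !inE.
    by apply/negP => /andP[/eqP -> /eqP eq_ij]; rewrite eq_ij eqxx in neq_ij.
  - apply/eqP/setP => v; rewrite inE; apply/bigcupP.
    by exists (f v); rewrite // ffunE inE.
case/andP => /and3P[/forallP B0 /forallP BD /eqP BU] avB.
have /fin_all_exists[f fB] : forall v : 'I_n, exists i, v \in B i.
  move=> v; have : v \in \bigcup_i B i by rewrite BU inE.
  by case/bigcupP => i _ vi; exists i.
have fBE v i : (v \in B i) = (f v == i).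
  apply/idP/eqP => [vi|<- //]; apply/eqP/negPn/negP => neq.
  have /forallP/(_ i)/implyP/(_ neq)/pred0P/(_ v) /= := BD (f v).
  by rewrite fB vi.
have BE : B = blocks (finfun f).
  by apply/ffunP => i; apply/setP => v; rewrite ffunE inE ffunE fBE.
exists (finfun f) => //; rewrite inE -BE avB andbT.
apply/forallP => i; have /set0Pn[v] := B0 i; rewrite fBE => fv.
by apply/existsP; exists v; rewrite ffunE.
Qed.

Section BlockOrder.
Variables (n k : nat) (f : {ffun 'I_n -> 'I_k}).

(** The strict total order in which the reading permutation lists the values. *)
Definition block_lt (u v : 'I_n) : bool :=
  (f u < f v) || (f u == f v) && (v < u).

Definition block_sorted (s : 'S_n) : bool :=
  [forall a : 'I_n, forall b : 'I_n, (a < b) ==> block_lt (s a) (s b)].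

Lemma block_sortedP (s : 'S_n) :
  reflect (forall a b : 'I_n, block_lt (s a) (s b) = (a < b)) (block_sorted s).
Proof.
apply: (iffP forallP) => [srt a b|srt a].
  have lt_s (c d : 'I_n) : c < d -> block_lt (s c) (s d).
    exact: (implyP (forallP (srt c) d)).
  case: (ltngtP a b) => [/lt_s //|/lt_s|/val_inj ->]; rewrite /block_lt -!val_eqE /=; lia.
by apply/forallP => b; apply/implyP; rewrite srt.
Qed.

(** The sorted permutation is the inverse of the rank function of [block_lt]. *)
Lemma block_sorted_unique : exists s : 'S_n, block_sorted =1 pred1 s.
Proof.
pose rank v := #|[set u | block_lt u v]|.
have rank_lt v : rank v < n.
  rewrite -[ltnRHS]card_ord -cardsT; apply: proper_card.
  by apply/properP; split=> //; exists v; rewrite ?inE // /block_lt; lia.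
have rank_mono u v : block_lt u v -> rank u < rank v.
  move=> lt_uv; apply: proper_card; apply/properP; split.
    by apply/subsetP => w; rewrite !inE; move: lt_uv; rewrite /block_lt -!val_eqE /=; lia.
  by exists u; rewrite !inE // /block_lt; lia.
have lt_total u v : [|| u == v, block_lt u v | block_lt v u].
  by rewrite /block_lt -!val_eqE /=; lia.
have rank_inj : injective (fun v => Ordinal (rank_lt v)).
  move=> u v [eq_rk]; case/or3P: (lt_total u v) => [/eqP //||] /rank_mono; lia.
exists (perm rank_inj)^-1%g => t; apply/idP/eqP => [/block_sortedP srt|->].
  have tK : (t * perm rank_inj = 1)%g.
    apply/permP => a; rewrite permM perm1 permE; apply: val_inj => /=.
    (* The elements preceding [t a] are the [t b] with [b < a], so its rank is [a]. *)
    rewrite -[RHS](card_ord_ltn (ltnW (ltn_ord a))) -(card_imset _ (@perm_inj _ t)).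
    apply: eq_card => u; rewrite -[u](permKV t) inE srt mem_imset ?inE //.
    exact: perm_inj.
  by apply/eqP; rewrite eq_mulgV1 invgK tK.
apply/forallP => a; apply/forallP => b; apply/implyP => lt_ab.
set s := (perm rank_inj)^-1%g.
have rank_s c : rank (s c) = c.
  by have := permKV (perm rank_inj) c; rewrite permE => /(congr1 val).
case/or3P: (lt_total (s a) (s b)) => [/eqP/perm_inj eq_ab|//|/rank_mono].
  by rewrite eq_ab ltnn in lt_ab.
by rewrite !rank_s; lia.
Qed.

(* Decreasing order inside the blocks means that an increasing pair of values
   is read in different blocks. *)
Lemma op_contains_blocks (s : 'S_n) : block_sorted s ->
  op_contains pat123 (blocks f) = perm_contains pat123 s.
Proof.
move=> /block_sortedP srt.
have srtV (u v : 'I_n) : u < v -> (f u < f v) = (s^-1%g u < s^-1%g v).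
  by move=> lt_uv; rewrite -srt !permKV /block_lt; lia.
apply/op_contains123P/perm_contains123P.
  move=> [i [j [l [a [b [c [/andP[ij jl] /andP[ab bc]]]]]]]].
  rewrite !ffunE !inE => -[/eqP fa /eqP fb /eqP fc].
  exists (s^-1%g a), (s^-1%g b), (s^-1%g c); rewrite !permKV -!srtV //.
  by rewrite fa fb fc.
move=> [a [b [c [ab bc sab sbc]]]].
exists (f (s a)), (f (s b)), (f (s c)), (s a), (s b), (s c).
by rewrite !ffunE !inE !eqxx !srtV // !permK ab bc sab sbc.
Qed.

End BlockOrder.

(** Double counting of the pairs of a block map and its unique reading permutation. *)
Lemma op_sum_sorted n k : op pat123 n k =
  \sum_(s : 'S_n | av123 s) #|[set f : {ffun 'I_n -> 'I_k} | surjb f && block_sorted f s]|.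
Proof.
rewrite op_surj -sum1dep_card.
transitivity (\sum_(f : {ffun 'I_n -> 'I_k} | surjb f && ~~ op_contains pat123 (blocks f))
    \sum_(s : 'S_n | block_sorted f s) 1).
  apply: eq_bigr => f _; have [s srt] := block_sorted_unique f.
  by rewrite (big_pred1 s).
rewrite (exchange_big_dep (@av123 n)) /=; last first.
  by move=> f s /andP[_ avf] srt; rewrite /av123 -(op_contains_blocks srt).
apply: eq_bigr => s avs; rewrite -sum1dep_card; apply: eq_bigl => f.
case: (boolP (block_sorted f s)) => [srt|_]; rewrite ?andbF //.
by rewrite (op_contains_blocks srt) (negPf avs) !andbT.
Qed.

(** * Block maps with a given reading permutation as sets of marked descents *)

Section MarkedDescents.
Variables (n k : nat) (s : 'S_n.+1).
Hypothesis le_kn : k <= n.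
Implicit Types (g : {ffun 'I_n.+1 -> 'I_k.+1}) (A : {set 'I_n.+1}).

Let desc : {set 'I_n.+1} :=
  [set a : 'I_n.+1 | [exists b : 'I_n.+1, (b == a.+1 :> nat) && (s b < s a)]].

(** Here [g a] stands for the block index of the letter [s a]: this is [block_sorted] transported
    along [s]. *)
Definition word_sorted g : bool :=
  [forall a : 'I_n.+1, forall b : 'I_n.+1,
    (a < b) ==> (g a < g b) || (g a == g b) && (s b < s a)].

Definition plateaus g : {set 'I_n.+1} :=
  [set a : 'I_n.+1 | [exists b : 'I_n.+1, (b == a.+1 :> nat) && (g b == g a)]].

Definition unmarked_before A (a : 'I_n.+1) : nat :=
  #|[set b : 'I_n.+1 | (b \notin A) && (b < a)]|.

(** A new block opens after every unmarked position, so a block index counts the unmarked positions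
    before it. The default of [inord] is not reached for the sets [A] of [word_of_marks_val]. *)
Definition word_of_marks A : {ffun 'I_n.+1 -> 'I_k.+1} :=
  [ffun a => inord (unmarked_before A a)].

Lemma unmarked_before_lt A (a b : 'I_n.+1) :
  a \notin A -> a < b -> unmarked_before A a < unmarked_before A b.
Proof.
move=> aA ab; apply: proper_card; apply/properP; split.
  by apply/subsetP => c; rewrite !inE => /andP[-> ca]; apply: ltn_trans ab.
by exists a; rewrite !inE ?aA ?ab ?ltnn.
Qed.

Lemma unmarked_before_next A (a b : 'I_n.+1) :
  a \in A -> b = a.+1 :> nat -> unmarked_before A b = unmarked_before A a.
Proof.
move=> aA eq_b; apply: eq_card => c; rewrite !inE eq_b ltnS leq_eqVlt.
by case: eqP => [/val_inj ->|//]; rewrite aA ltnn.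
Qed.

Lemma desc_card : des s = #|desc|. Proof. by []. Qed.

(** The count stays below [k.+1], the number of unmarked positions: the last position is no descent,
    hence unmarked, and precedes nothing. *)
Lemma word_of_marks_val A (a : 'I_n.+1) : A \subset desc -> #|A| = n - k ->
  word_of_marks A a = unmarked_before A a :> nat.
Proof.
move=> sub_A card_A; have card_AC : #|~: A| = k.+1.
  by have := cardsC A; rewrite card_ord card_A; lia.
rewrite ffunE inordK // -card_AC; apply: proper_card; apply/properP; split.
  by apply/subsetP => c; rewrite !inE => /andP[].
exists ord_max; rewrite !inE; last by rewrite ltnNge -ltnS ltn_ord andbF.
apply/negP => /(subsetP sub_A); rewrite inE => /existsP[b /andP[/eqP eq_b _]].
by have := ltn_ord b; rewrite eq_b ltnn.
Qed.

Lemma word_of_marks_sorted A : A \subset desc -> #|A| = n - k ->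
  surjb (word_of_marks A) && word_sorted (word_of_marks A).
Proof.
move=> sub_A card_A.
have wE a := word_of_marks_val a sub_A card_A.
have card_AC : #|~: A| = k.+1.
  by have := cardsC A; rewrite card_ord card_A; lia.
apply/andP; split.
  (* Unmarked positions get distinct indices, and there are [k.+1] of them. *)
  have /eqP imT : word_of_marks A @: (~: A) == [set: 'I_k.+1].
    rewrite eqEcard subsetT cardsT card_ord card_in_imset; first by rewrite card_AC leqnn.
    move=> a b; rewrite !inE => aA bA /(congr1 val); rewrite /= !wE => eq_ab.
    case: (ltngtP a b) => [/(unmarked_before_lt aA)|/(unmarked_before_lt bA)|/val_inj //].
      by rewrite eq_ab ltnn.
    by rewrite eq_ab ltnn.
  apply/forallP => i; have : i \in word_of_marks A @: (~: A) by rewrite imT.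
  by case/imsetP => a _ ->; apply/existsP; exists a.
apply/forallP => a; apply/forallP => b; apply/implyP.
(* By transitivity only consecutive positions matter: a marked one keeps the index and is a descent
   of [s], an unmarked one raises the index. *)
pose r := [rel a b : 'I_n.+1 | (word_of_marks A a < word_of_marks A b) ||
  (word_of_marks A a == word_of_marks A b) && (s b < s a)].
move: a b; apply: (@ord_ltn_trans_next _ r) => [b a c|a b eq_b].
  by rewrite /= -!val_eqE /=; lia.
rewrite /= -val_eqE /= !wE; case: (boolP (a \in A)) => [aA|aA].
  rewrite (unmarked_before_next aA eq_b) ltnn eqxx /=.
  have := subsetP sub_A _ aA; rewrite inE => /existsP[c /andP[/eqP eq_c]].
  by rewrite (_ : c = b) //; apply: val_inj; apply: etrans eq_c (esym eq_b).
by rewrite unmarked_before_lt // eq_b.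
Qed.

Lemma word_of_marksK A : A \subset desc -> #|A| = n - k ->
  plateaus (word_of_marks A) = A.
Proof.
move=> sub_A card_A; have wE a := word_of_marks_val a sub_A card_A.
apply/setP => a; rewrite inE; apply/existsP/idP => [[b /andP[/eqP eq_b]]|aA].
  rewrite -val_eqE /= !wE; apply: contraTT => aA.
  by rewrite gtn_eqF // unmarked_before_lt // eq_b.
have := subsetP sub_A _ aA; rewrite inE => /existsP[b /andP[/eqP eq_b _]].
exists b; rewrite eq_b eqxx -val_eqE /= !wE.
by rewrite (unmarked_before_next aA eq_b).
Qed.

Section FromWord.
Variable g : {ffun 'I_n.+1 -> 'I_k.+1}.
Hypotheses (g_surj : surjb g) (g_sorted : word_sorted g).

Let g_lt (a b : 'I_n.+1) : a < b -> (g a < g b) || (g a == g b) && (s b < s a).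
Proof. exact: (implyP (forallP (forallP g_sorted a) b)). Qed.

Let g_le (a b : 'I_n.+1) : a <= b -> g a <= g b.
Proof.
rewrite leq_eqVlt => /predU1P[/val_inj -> //|/g_lt].
by rewrite -val_eqE /=; lia.
Qed.

Let g_lt_unmarked (a b : 'I_n.+1) : a \notin plateaus g -> a < b -> g a < g b.
Proof.
move=> aP ab; have lt_a : a.+1 < n.+1 by apply: leq_ltn_trans (ltn_ord b).
apply: leq_trans (g_le (ab : Ordinal lt_a <= b)).
rewrite ltn_neqAle g_le ?leqnSn // andbT; apply: contra aP => eq_g.
by rewrite inE; apply/existsP; exists (Ordinal lt_a); rewrite eqxx eq_sym.
Qed.

Let g_inj : {in ~: plateaus g &, injective g}.
Proof.
move=> a b; rewrite !in_setC => aP bP eq_g.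
case: (ltngtP a b) => [/(g_lt_unmarked aP)|/(g_lt_unmarked bP)|/val_inj //].
  by rewrite eq_g ltnn.
by rewrite eq_g ltnn.
Qed.

Let last_in_block (i : 'I_k.+1) : exists2 a, a \in ~: plateaus g & g a = i.
Proof.
have /existsP[a0 ga0] := forallP g_surj i.
case: (@arg_maxnP _ a0 (fun a => g a == i) (@nat_of_ord n.+1) ga0) => a /eqP ga a_max.
exists a => //; rewrite !inE; apply/existsP => -[b /andP[/eqP eq_b /eqP gb]].
have := a_max b; rewrite gb ga eqxx => /(_ isT); rewrite /= eq_b ltnn //.
Qed.

Lemma plateaus_desc : plateaus g \subset desc.
Proof.
apply/subsetP => a; rewrite !inE => /existsP[b /andP[/eqP eq_b /eqP gb]].
apply/existsP; exists b; rewrite eq_b eqxx /=.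
have ab : a < b by rewrite eq_b.
by have := g_lt ab; rewrite gb ltnn eqxx.
Qed.

(** Each block has exactly one position outside the plateaus, its last one. *)
Lemma card_plateaus : #|plateaus g| = n - k.
Proof.
have : #|~: plateaus g| = k.+1.
  rewrite -(card_in_imset g_inj) -[RHS]card_ord -cardsT; congr #|pred_of_set _|.
  apply/setP => i; rewrite inE; apply/imsetP.
  by have [a aP <-] := last_in_block i; exists a.
by have := cardsC (plateaus g); rewrite card_ord; lia.
Qed.

(** Non-plateau positions before [a] correspond to the indices below [g a], one for each block
    already finished. *)
Lemma plateausK : word_of_marks (plateaus g) = g.
Proof.
apply/ffunP => a; apply: val_inj.
rewrite /= word_of_marks_val ?plateaus_desc ?card_plateaus //.
rewrite -[RHS](card_ord_ltn (ltnW (ltn_ord (g a)))) /unmarked_before.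
rewrite -(@card_in_imset _ _ g); last first.
  move=> b c; rewrite inE => /andP[bP _]; rewrite inE => /andP[cP _].
  by apply: g_inj; rewrite inE.
apply: eq_card => i; rewrite inE; apply/imsetP/idP => [[b]|lt_i].
  by rewrite inE => /andP[bP ba] ->; apply: g_lt_unmarked.
have [b bP gb] := last_in_block i; exists b => //.
rewrite inE -in_setC bP /= ltnNge; apply/negP => /g_le.
by rewrite gb leqNgt lt_i.
Qed.

End FromWord.

(** [plateaus] and [word_of_marks] are inverse bijections between these words and the sets of
    [n - k] descents of [s]. *)
Lemma card_word_sorted :
  #|[set g : {ffun 'I_n.+1 -> 'I_k.+1} | surjb g && word_sorted g]|
  = 'C(des s, n - k).
Proof.
rewrite desc_card -cards_draws -(@card_in_imset _ _ word_of_marks).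
  apply: eq_card => g; rewrite inE; apply/idP/imsetP => [/andP[gS gW]|[A]].
    exists (plateaus g); last by rewrite plateausK.
    by rewrite inE plateaus_desc // card_plateaus // eqxx.
  by rewrite inE => /andP[sA /eqP cA] ->; apply: word_of_marks_sorted.
move=> A B; rewrite !inE => /andP[sA /eqP cA] /andP[sB /eqP cB] eqAB.
by rewrite -(word_of_marksK sA cA) eqAB word_of_marksK.
Qed.

Lemma card_block_sorted_pos :
  #|[set f : {ffun 'I_n.+1 -> 'I_k.+1} | surjb f && block_sorted f s]|
  = 'C(des s, n - k).
Proof.
(* Composing a block map with [s] gives its word of block indices. *)
pose pull (p : 'S_n.+1) (f : {ffun 'I_n.+1 -> 'I_k.+1}) := [ffun a => f (p a)].
have pullK p q : (p * q = 1)%g -> cancel (pull q) (pull p).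
  by move=> pq f; apply/ffunP => a; rewrite !ffunE -permM pq perm1.
rewrite -card_word_sorted -(card_imset _ (can_inj (pullK _ _ (mulVg s)))).
apply: eq_card => g; rewrite inE.
have -> : g = pull s (pull s^-1%g g) by rewrite pullK // mulgV.
move: (pull _ g) => {g} f; rewrite mem_imset; last exact: can_inj (pullK _ _ (mulVg s)).
rewrite inE; congr (_ && _).
  apply/forallP/forallP => f_surj i; have /existsP[a fa] := f_surj i; apply/existsP.
    by exists (s^-1%g a); rewrite ffunE permKV.
  by exists (s a); rewrite ffunE in fa.
by apply: eq_forallb => a; apply: eq_forallb => b; rewrite !ffunE.
Qed.

End MarkedDescents.

Lemma des_lt_size n (s : 'S_n.+1) : des s < n.+1.
Proof.
rewrite -[ltnRHS]card_ord -cardsT; apply: proper_card; apply/properP; split=> //.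
exists ord_max; rewrite ?inE //; apply/existsP => -[b /andP[/eqP eq_b _]].
by have := ltn_ord b; rewrite eq_b ltnn.
Qed.

Lemma card_block_sorted n k (s : 'S_n) : k <= n ->
  #|[set f : {ffun 'I_n -> 'I_k} | surjb f && block_sorted f s]| = 'C(des s, n - k).
Proof.
case: n s => [|n] s le_kn.
  move: le_kn; rewrite leqn0 => /eqP ->; rewrite bin0.
  rewrite -[RHS](_ : #|{ffun 'I_0 -> 'I_0}| = 1); last by rewrite card_ffun !card_ord.
  rewrite -cardsT; congr #|pred_of_set _|; apply/setP => f; rewrite !inE.
  by apply/andP; split; apply/forallP => -[].
case: k le_kn => [|k] le_kn; last by rewrite subSS card_block_sorted_pos.
(* With no block and a nonempty ground set both sides vanish: there is no map into ['I_0], and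
   [des s] is below the size. *)
rewrite bin_small ?subn0 ?des_lt_size //; apply: eq_card0 => f.
by have [] := f ord0.
Qed.

Lemma op123_sum_des n k : k <= n ->
  op pat123 n k = \sum_(s : 'S_n | av123 s) 'C(des s, n - k).
Proof.
move=> le_kn; rewrite op_sum_sorted; apply: eq_bigr => s _.
exact: card_block_sorted.
Qed.

(** * Descent polynomials along the generating tree *)

Local Open Scope ring_scope.

(* Sum of [v ^+ (number of descents created)] over the ways of adding [m] first
   letters to a 123-avoiding [s] with [top_run s = l] and [max_first s = b] so that
   it stays 123-avoiding. *)
Fixpoint subtree_weight (R : pzSemiRingType) (v : R) (m : nat) (b : bool)
    (l : nat) : R :=
  if m is m'.+1 then
    v * subtree_weight v m' true l.+1
    + (if b then 1 else v) * \sum_(i < l) subtree_weight v m' false i.+1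
  else 1.

Section DescentSum.
Variables (R : comNzRingType) (v : R).

(** The new letter [ord_max] always makes a descent and lengthens the run by one. Any other
    admissible [j] exceeds the first letter of [s] unless that letter is the maximum, since
    otherwise it is below [asc_bound s]; hence the factor [v] or [1]. *)
Lemma sum_av123_first n (Phi : bool -> nat -> R) :
  \sum_(t : 'S_n.+2 | av123 t) v ^+ des t * Phi (max_first t) (top_run t)
  = \sum_(s : 'S_n.+1 | av123 s) v ^+ des s *
      (v * Phi true (top_run s).+1
       + (if max_first s then 1 else v) * \sum_(i < top_run s) Phi false i.+1).
Proof.
rewrite big_mkcond big_perm_first [RHS]big_mkcond; apply: eq_bigr => s _ /=.
case: (boolP (av123 s)) => av; last first.
  by rewrite big1 // => j _; rewrite av123_lift (negPf av).
have szb := asc_bound_size s.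
rewrite big_ord_recr /= av123_lift av szb /= max_first_lift eqxx des_lift.
rewrite /top_run asc_bound_lift // eqxx ltn_ord add1n subSn // exprS.
rewrite addrC mulrDr mulrCA; congr (_ + _); first by ring.
(* The letter [j] leaves a run of length [n.+1 - j], which takes each value from 1 to [top_run s]
   once. *)
have widthE : \sum_(i < n.+1 - asc_bound s) Phi false i.+1
    = \sum_(j < n.+1 | (asc_bound s <= j)%N) Phi false (n.+1 - j)%N.
  rewrite (big_ord_widen n.+1 (fun i => Phi false i.+1)) ?leq_subr // (reindex_inj rev_ord_inj) /=.
  apply: eq_big => [i|i _]; last by rewrite subSS subSn //; have := ltn_ord i; lia.
  by have := ltn_ord i; lia.
rewrite widthE !mulr_sumr [RHS]big_mkcond; apply: eq_bigr => j _ /=.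
have jn := ltn_ord j.
rewrite av123_lift av /=; case: ifP => // le_j.
have jmax : (widen_ord (leqnSn n.+1) j == ord_max) = false.
  by rewrite -val_eqE /= ltn_eqF.
rewrite max_first_lift asc_bound_lift // jmax des_lift /= subSS mulrA; congr (_ * _).
case: ifPn => mx.
  by rewrite (eqP mx) /= ltnNge -ltnS jn /= mulr1.
by rewrite (leq_trans (ltn_asc_bound_first mx) le_j) add1n exprSr.
Qed.

(** Each use of [sum_av123_first] moves one letter from the permutation into the tree below it,
    until the one-letter permutation remains. *)
Lemma sum_av123_subtree n m :
  \sum_(s : 'S_n.+1 | av123 s)
     v ^+ des s * subtree_weight v m (max_first s) (top_run s)
  = subtree_weight v (n + m) true 1.
Proof.
elim: n m => [|n IHn] m; last first.
  by rewrite (sum_av123_first _ (subtree_weight v m)) addSnnS -IHn.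
rewrite (big_pred1 1%g) => [|s].
  have -> : des (1%g : 'S_1) = 0%N.
    apply: eq_card0 => i; rewrite !inE; apply/existsP => -[k /andP[/eqP]].
    by rewrite [k]ord1.
  have -> : max_first (1%g : 'S_1) by rewrite /max_first perm1 -val_eqE.
  have -> : top_run (1%g : 'S_1) = 1%N.
    rewrite /top_run /asc_bound big_pred0 // => i.
    by apply/existsP => -[k]; rewrite [k]ord1 [i]ord1.
  by rewrite mul1r.
have -> : s = 1%g by apply/permP => i; rewrite !ord1.
rewrite /= eqxx; apply/negP => /perm_contains123P[a [b [c []]]].
by rewrite [a]ord1 [b]ord1.
Qed.

Lemma sum_av_des n :
  \sum_(d < n.+1) (av_des pat123 n d)%:R * v ^+ d
  = \sum_(s : 'S_n | av123 s) v ^+ des s.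
Proof.
have des_lt (s : 'S_n) : (des s < n.+1)%N.
  by rewrite ltnS -[leqRHS]card_ord max_card.
rewrite (partition_big (fun s => Ordinal (des_lt s)) predT) //=.
apply: eq_bigr => d _; rewrite /av_des mulr_natl -sumr_const.
apply: eq_big => [s|s]; first by rewrite inE.
by rewrite inE => /andP[_ /eqP ->].
Qed.

End DescentSum.

(** * Coefficients of products and of [bgf] *)

Section FpsCoefficients.
Variable R : comNzRingType.
Implicit Types (f g : fps R) (c : R).

Lemma fcoef_fpsC_mul c f n : fcoef (fpsC c * f) n = c * fcoef f n.
Proof.
rewrite fcoefM big_ord_recl subn0 big1 ?addr0 // => i _.
by rewrite fcoefC mul0r.
Qed.

Lemma fcoef_fpsX_mul f n : fcoef (fpsX R * f) n.+1 = fcoef f n.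
Proof.
rewrite fcoefM big_ord_recl mul0r add0r big_ord_recl mul1r subn1 big1 ?addr0 //.
by move=> i _; rewrite fcoefX mul0r.
Qed.

Lemma fcoef0M f g : fcoef (f * g) 0 = fcoef f 0 * fcoef g 0.
Proof. by rewrite fcoefM big_ord1. Qed.

Lemma fcoef0X f n : fcoef (f ^+ n) 0 = fcoef f 0 ^+ n.
Proof. by elim: n => // n IHn; rewrite !exprS fcoef0M IHn. Qed.

Lemma fcoef_fpsX_exp_mul f k n : fcoef (fpsX R ^+ k * f) (k + n)%N = fcoef f n.
Proof. by elim: k => [|k IHk]; rewrite ?mul1r // exprS -mulrA fcoef_fpsX_mul. Qed.

(** As [u] is a constant times [x], only the term [i = n] reaches degree [n]. *)
Lemma fcoef_bgf (a : nat -> nat -> nat) c v n :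
  fcoef (bgf a (fpsX R * fpsC c) (fpsC v)) n
  = c ^+ n * \sum_(d < n.+1) (a n d)%:R * v ^+ d.
Proof.
have polyC i : \sum_(d < i.+1) (a i d)%:R * fpsC v ^+ d
    = fpsC (\sum_(d < i.+1) (a i d)%:R * v ^+ d).
  by rewrite rmorph_sum; apply: eq_bigr => d _; rewrite rmorphM rmorph_nat rmorphXn.
rewrite [LHS]fcoef_sum big_ord_recr big1 ?[LHS]add0r => [|i _].
  rewrite polyC exprMn mulrCA -[X in fcoef _ X]addn0 fcoef_fpsX_exp_mul fcoef0M -rmorphXn.
  by rewrite !fcoefC mulrC.
rewrite polyC exprMn mulrCA -rmorphXn -rmorphM.
rewrite -[X in fcoef _ X](subnKC (ltnW (ltn_ord i))) fcoef_fpsX_exp_mul fcoefC.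
by rewrite subn_eq0 leqNgt ltn_ord.
Qed.

End FpsCoefficients.

(** * The quadratic equation of [G] and the weights as coefficients of its powers *)

Section Algebra.
Variables (K : fieldType) (Y : K).
Hypotheses (Y_neq0 : Y != 0) (Y1_neq0 : 1 + Y != 0) (two_neq0 : 2%:R != 0 :> K).

Let x := fpsX K.
Let y := fpsC Y.
Let c := x * (1 - x) * (1 + y).

(** [G] is [(1 - s) / (2 c)]. As [c] is not invertible, the division goes factor by factor: [x]
    divides [1 - s] because [s] has constant term 1, [1 - x] has the geometric series as inverse,
    and [2 (1 + Y)] is a nonzero scalar. *)
Lemma quadratic_solution : exists G : fps K, 
  [/\ fcoef G 0 = 1, G = 1 + c * G ^+ 2 & fps_sqrt (1 - 4%:R * c) = 1 - 2%:R * c * G].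
Proof.
set s := fps_sqrt _.
have c0 : fcoef c 0 = 0 by rewrite /c -mulrA fcoef0M mul0r.
have sK : s ^+ 2 = 1 - 4%:R * c.
  by apply: fps_sqrtK => //; rewrite fcoefB fcoef0M c0 mulr0 subr0.
pose q : fps K := Fps (fun n => fcoef (1 - s) n.+1).
have sq : 1 - s = x * q.
  apply/fpsP => -[|n]; last by rewrite fcoef_fpsX_mul.
  by rewrite fcoef0M mul0r fcoefB fps_sqrt0 subrr.
pose geom : fps K := Fps (fun=> 1).
have geomV : (1 - x) * geom = 1.
  apply/fpsP => -[|n]; rewrite mulrBl mul1r fcoefB ?fcoef_fpsX_mul ?subrr //.
  by rewrite fcoef0M mul0r subr0.
pose k := fpsC ((2%:R * (1 + Y))^-1).
have kV : 2%:R * (1 + y) * k = 1.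
  rewrite /k /y -(rmorph_nat (@fpsC K)) -(rmorph1 (@fpsC K)) -rmorphD -!rmorphM.
  by rewrite mulfV // mulf_neq0.
pose G := q * geom * k.
have sG : 2%:R * c * G = 1 - s.
  have -> : 2%:R * c * G = x * q * (2%:R * (1 + y) * k) * ((1 - x) * geom).
    by rewrite /c /G; ring.
  by rewrite kV geomV !mulr1 sq.
have x0 : x != 0 by apply/eqP => /fpsP/(_ 1%N)/eqP; rewrite fcoefX oner_eq0.
have cn0 : 2%:R * c != 0.
  have : 2%:R * c * (geom * k) = x.
    have -> : 2%:R * c * (geom * k) = x * (2%:R * (1 + y) * k) * ((1 - x) * geom).
      by rewrite /c; ring.
    by rewrite kV geomV !mulr1.
  by apply: contra_eq_neq => ->; rewrite mul0r eq_sym.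
have GE : G = 1 + c * G ^+ 2.
  (* Multiplying by [4 c] completes the square and reduces the equation to [s ^+ 2 = 1 - 4 c]. *)
  have c2n0 : 2%:R * (2%:R * c) != 0.
    have -> : 2%:R * (2%:R * c) = fpsC 2%:R * (2%:R * c) by rewrite rmorph_nat.
    rewrite mulf_neq0 //; apply/eqP => /fpsP/(_ 0%N)/eqP.
    by rewrite fcoefC (negPf two_neq0).
  apply: (mulfI c2n0).
  have -> : 2%:R * (2%:R * c) * (1 + c * G ^+ 2)
      = 4%:R * c + (2%:R * c * G) ^+ 2 by ring.
  have -> : 2%:R * (2%:R * c) * G = 2%:R * (2%:R * c * G) by ring.
  rewrite sG.
  have -> : 4%:R * c = 1 - s ^+ 2 by rewrite sK; ring.
  ring.
exists G; split=> //; last by rewrite sG; ring.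
by rewrite GE fcoefD fcoef0M c0 mul0r addr0.
Qed.

(** Both families satisfy the recursion of [subtree_weight] in [m]. With [v = 1 + Y^-1] the scaling
    by [Y ^+ m] turns the factor [v] into [1 + Y] and the factor [1] into [Y]; the difference 1 is
    the subtracted multiple of [x]. *)
Lemma fcoef_subtree_weight (G : fps K) : fcoef G 0 = 1 -> G = 1 + c * G ^+ 2 ->
  forall m l,
    fcoef (G ^+ l.+1) m = Y ^+ m * subtree_weight (1 + Y^-1) m false l /\
    fcoef (G ^+ l.+1 - x * \sum_(i < l) G ^+ i.+2) m
      = Y ^+ m * subtree_weight (1 + Y^-1) m true l.
Proof.
move=> G0 GE.
pose S l := \sum_(i < l) G ^+ i.+2.
(* Telescoping of [G ^+ l.+2 = G ^+ l.+1 + c * G ^+ l.+3]. *)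
have powE l : G ^+ l.+1 = 1 + c * S l.+1.
  elim: l => [|l IHl]; first by rewrite /S big_ord1.
  rewrite /S big_ord_recr /= mulrDr addrA -IHl exprS {1}GE mulrDl mul1r -mulrA -exprD.
  by congr (_ + _).
(* Expand the factor [1 - x] of [c] and split [G ^+ l.+2] off [S l.+1]. *)
have HE l : G ^+ l.+1 = 1 + x * ((1 + y) * (G ^+ l.+2 - x * S l.+1) + (1 + y) * S l).
  by rewrite powE /S big_ord_recr /=  /c; ring.
have KE l : G ^+ l.+1 - x * S l
    = 1 + x * ((1 + y) * (G ^+ l.+2 - x * S l.+1) + y * S l).
  by rewrite HE; ring.
have YV : Y * (1 + Y^-1) = 1 + Y by rewrite mulrDr mulr1 mulfV // addrC.
have y1 : 1 + y = fpsC (1 + Y) by rewrite rmorphD rmorph1.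
elim=> [|m IHm] l.
  rewrite fcoefB fcoef0M !fcoef0X G0 expr1n.
  by rewrite mul0r subr0 !mulr1.
have [_ Ktop] := IHm l.+1.
have sumS : fcoef (S l) m
    = Y ^+ m * \sum_(i < l) subtree_weight (1 + Y^-1) m false i.+1.
  by rewrite fcoef_sum mulr_sumr; apply: eq_bigr => i _; case: (IHm i.+1).
have one0 : fcoef (1 : fps K) m.+1 = 0 by [].
split; [rewrite HE | rewrite -/(S l) KE];
  by rewrite fcoefD one0 fcoef_fpsX_mul fcoefD y1 !fcoef_fpsC_mul Ktop sumS -YV exprS /=;
    ring.
Qed.

End Algebra.

(** * The two identities for [F] *)

Section ClosedForm.
Variables (K : fieldType) (Y : K).
Hypothesis Y_neq0 : Y != 0.

Let x := fpsX K.
Let y := fpsC Y.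

Lemma fcoef_E n : fcoef (E (x * y) (1 + y^-1)) n
  = Y ^+ n * \sum_(s : 'S_n | av123 s) (1 + Y^-1) ^+ des s.
Proof.
rewrite /E /y fpsC_inv // -(rmorph1 (@fpsC K)) -rmorphD fcoef_bgf.
by rewrite sum_av_des.
Qed.

(** The binomial theorem indexed by [n - k]; the terms with [n - k > d] vanish. *)
Lemma sum_bin_rev (d n : nat) : (d <= n)%N ->
  \sum_(k < n.+1) 'C(d, n - k)%:R * Y ^+ k = Y ^+ n * (1 + Y^-1) ^+ d.
Proof.
move=> le_dn; rewrite exprDn mulr_sumr.
rewrite (big_ord_widen n.+1 (fun i => Y ^+ n * ((1 ^+ (d - i) * Y^-1 ^+ i) *+ 'C(d, i)))) //.
rewrite (reindex_inj rev_ord_inj) [RHS]big_mkcond; apply: eq_bigr => i _ /=.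
have le_in : (i <= n)%N by rewrite -ltnS.
rewrite subSS subKn //; case: ltnP => [_|lt_di]; last by rewrite bin_small ?mul0r.
rewrite expr1n mul1r mulrnAr mulr_natl; congr (_ *+ _).
by rewrite exprB ?unitfE // exprVn.
Qed.

Lemma F_eq_E : F x y = E (x * y) (1 + y^-1).
Proof.
apply/fpsP => n; rewrite fcoef_E /F -[x]mulr1 -(rmorph1 (@fpsC K)) fcoef_bgf.
rewrite expr1n mul1r mulr_sumr.
transitivity (\sum_(k < n.+1) \sum_(s : 'S_n | av123 s) 'C(des s, n - k)%:R * Y ^+ k).
  apply: eq_bigr => k _; rewrite op123_sum_des -1?ltnS // natr_sum.
  by rewrite mulr_suml.
rewrite exchange_big; apply: eq_bigr => s _; apply: sum_bin_rev.
by rewrite -[leqRHS]card_ord max_card.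
Qed.

Hypotheses (Y1_neq0 : 1 + Y != 0) (two_neq0 : 2%:R != 0 :> K).

Lemma F_closed_form :
  F x y * (2%:R * x * (y + 1) ^+ 2 * (x - 1)) =
    - y - 2%:R * x * y - 2%:R * x + 2%:R * x ^+ 2 * y + 2%:R * x ^+ 2
    + y * fps_sqrt (1 - 4%:R * x * y - 4%:R * x
                    + 4%:R * x ^+ 2 * y + 4%:R * x ^+ 2).
Proof.
have [G [G0 GE sqrtE]] := quadratic_solution Y1_neq0 two_neq0.
(* Nonempty 123-avoiding permutations descend from the one-letter one, which starts with its maximum
   and has run length 1. This is the case [l = 1] of the second family, and [x y] accounts for that
   letter. *)
have FE : F x y = 1 + x * (y * (G ^+ 2 - x * G ^+ 2)).
  apply/fpsP => -[|n]; rewrite F_eq_E fcoef_E fcoefD.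
    rewrite fcoef0M mul0r addr0 mul1r (big_pred1 1%g) => [|s].
      by rewrite (_ : des _ = 0%N) //; apply: eq_card0 => -[].
    have -> : s = 1%g by apply/permP => -[].
    by rewrite /= eqxx; apply/perm_contains123P => -[[]].
  have [_] := fcoef_subtree_weight Y_neq0 G0 GE n 1.
  rewrite big_ord1 fcoef_fpsX_mul fcoef_fpsC_mul => ->.
  have -> : fcoef (1 : fps K) n.+1 = 0 by [].
  rewrite add0r mulrA -exprS -[X in subtree_weight _ X]addn0 -sum_av123_subtree.
  by congr (_ * _); apply: eq_bigr => s _; rewrite mulr1.
have -> : 1 - 4%:R * x * y - 4%:R * x + 4%:R * x ^+ 2 * y + 4%:R * x ^+ 2
    = 1 - 4%:R * (x * (1 - x) * (1 + y)) by ring.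
rewrite sqrtE FE -/x -/y.
have -> : 1 + x * (y * (G ^+ 2 - x * G ^+ 2)) = 1 + x * (1 - x) * y * G ^+ 2 by ring.
(* Regroup so that [G ^+ 2] occurs only in a product that the quadratic equation replaces by
   [G - 1]. *)
transitivity (- (2%:R * x * (1 - x) * (1 + y)) *
    (1 + y + y * (x * (1 - x) * (1 + y) * G ^+ 2))); first by ring.
have -> : x * (1 - x) * (1 + y) * G ^+ 2 = G - 1.
  by apply/eqP; rewrite eq_sym subr_eq addrC; apply/eqP.
by ring.
Qed.

(** The denominator has constant term 0, so it is no unit among power series; the quotient is taken
    in their field of fractions. *)
Lemma F_closed_form_frac :
  (F x y)%:F =
    (- y - 2%:R * x * y - 2%:R * x + 2%:R * x ^+ 2 * y + 2%:R * x ^+ 2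
     + y * fps_sqrt (1 - 4%:R * x * y - 4%:R * x
                     + 4%:R * x ^+ 2 * y + 4%:R * x ^+ 2))%:F
    / (2%:R * x * (y + 1) ^+ 2 * (x - 1))%:F.
Proof.
have fpsC_neq0 (c : K) : c != 0 -> fpsC c != 0.
  by move=> c0; apply/eqP => /fpsP/(_ 0%N)/eqP; rewrite fcoefC (negPf c0).
have two0 : 2%:R != 0 :> fps K by rewrite -(rmorph_nat (@fpsC K)) fpsC_neq0.
have x0 : x != 0 by apply/eqP => /fpsP/(_ 1%N)/eqP; rewrite fcoefX oner_eq0.
have y10 : y + 1 != 0 by rewrite addrC -(rmorph1 (@fpsC K)) -rmorphD fpsC_neq0.
have x10 : x - 1 != 0.
  apply/eqP => /fpsP/(_ 1%N)/eqP; rewrite fcoefB fcoefX fcoefC subr0.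
  by rewrite oner_eq0.
have den0 : 2%:R * x * (y + 1) ^+ 2 * (x - 1) != 0.
  by rewrite (mulf_neq0 (mulf_neq0 (mulf_neq0 two0 x0) (expf_neq0 2 y10)) x10).
by rewrite -F_closed_form tofracM mulfK // tofrac_eq0.
Qed.

End ClosedForm.

Theorem theorem2p1 :
  let x : fps Qy := fpsX Qy in
  let y : fps Qy := fpsC (R := Qy) ('X : {poly rat})%:F in
  F x y = E (x * y) (1 + y^-1)
  /\
  (F x y)%:F =
    (- y - 2%:R * x * y - 2%:R * x + 2%:R * x ^+ 2 * y + 2%:R * x ^+ 2
     + y * fps_sqrt (1 - 4%:R * x * y - 4%:R * x
                     + 4%:R * x ^+ 2 * y + 4%:R * x ^+ 2))%:F
    / (2%:R * x * (y + 1) ^+ 2 * (x - 1))%:F.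
Proof.
have X0 : (('X : {poly rat})%:F : Qy) != 0 by rewrite tofrac_eq0 polyX_eq0.
have X1 : 1 + (('X : {poly rat})%:F : Qy) != 0.
  by rewrite -tofrac1 -tofracD tofrac_eq0 addrC -polyC1 -size_poly_eq0 size_XaddC.
have two0 : 2%:R != 0 :> Qy.
  by rewrite -tofrac1 -tofracMn tofrac_eq0 -polyC1 -polyCMn polyC_eq0.
exact (conj (@F_eq_E Qy _ X0) (@F_closed_form_frac Qy _ X0 X1 two0)).
Qed.
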